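(* Let $T$ be a finite tree, not isomorphic to $K_2$, whose centre consists of a single vertex, or of the two endpoints of an edge where each of these endpoints is fixed by every automorphism of $T$. Then $OD'^-(T)=\lceil D'(T)/2\rceil$ and $OD'^+(T)=D'(T)$.
   Context: The centre of a tree (the set of vertices of minimum eccentricity) consists of a single vertex or of the two endpoints of an edge. Write $[k]=\{1,\ldots,k\}$. For a graph $G$, an edge colouring $c\colon E(G)\to[k]$ (not necessarily proper) breaks an automorphism $\varphi\in\operatorname{Aut}(G)$ if some edge $xy$ satisfies $c(\varphi(x)\varphi(y))\neq c(xy)$; it is distinguishing if it breaks every non-trivial automorphism of $G$. The distinguishing index $D'(G)$ is the least integer $k\ge 1$ for which $G$ has a distinguishing colouring $E(G)\to[k]$. For a digraph, automorphisms preserve arcs together with their directions, and distinguishing arc colourings and the distinguishing index $D'$ are defined in the same way with arcs in place of edges. An orientation of $G$ is a digraph $\overrightarrow{G}$ obtained from $G$ by replacing each edge $xy$ with exactly one of the arcs $\overrightarrow{xy}$, $\overrightarrow{yx}$. Define $OD'^-(G)=\min D'(\overrightarrow{G})$ and $OD'^+(G)=\max D'(\overrightarrow{G})$, both over all orientations $\overrightarrow{G}$ of $G$. *)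

(* Defs.v *)
From mathcomp Require Import all_boot all_fingroup.
Set Implicit Arguments.
Unset Strict Implicit.
Unset Printing Implicit Defensive.

Definition is_tree (V : finType) (e : rel V) : Prop :=
  [/\ symmetric e, irreflexive e, 0 < #|V|,
      forall x y, connect e x y
    & forall s : seq V, 2 < size s -> ~ ucycle e s].

Definition complete_graph (n : nat) : rel 'I_n := fun i j => i != j.

Definition isomorphic (V W : finType) (e : rel V) (e' : rel W) : Prop :=
  exists2 f : V -> W, bijective f & forall x y, e' (f x) (f y) = e x y.

(* A walk with [n] edges from [x] to [y] is a [path] with [n] vertices after
   [x]; a shortest one has fewer than [#|V|] edges, so the search bound is
   never reached in a connected graph. *)
Definition dist (V : finType) (e : rel V) (x y : V) : nat :=
  find (fun n => [exists p : n.-tuple V, path e x p && (last x p == y)])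
       (iota 0 #|V|).

Definition eccentricity (V : finType) (e : rel V) (x : V) : nat :=
  \max_(y : V) dist e x y.

Definition centre (V : finType) (e : rel V) : {set V} :=
  [set x | [forall y, eccentricity e x <= eccentricity e y]].

(* For a symmetric [r] these are graph automorphisms, in general digraph
   automorphisms ([r x y] being the arc from [x] to [y]). *)
Definition is_aut (V : finType) (r : rel V) (phi : {perm V}) : Prop :=
  forall x y, r (phi x) (phi y) = r x y.

(* Colourings are total functions on unordered pairs (graphs), resp. ordered
   pairs (digraphs); only their values on edges, resp. arcs, matter.  As only
   [k >= 1] colours are considered below, every colouring of the edges or arcs
   extends to such a function.  The colour set [k] is ['I_k]. *)
Definition edge_breaks (V : finType) (e : rel V) (k : nat)
    (c : {set V} -> 'I_k) (phi : {perm V}) : Prop :=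
  exists x y, e x y /\ c [set phi x; phi y] <> c [set x; y].

Definition arc_breaks (V : finType) (r : rel V) (k : nat)
    (c : V -> V -> 'I_k) (phi : {perm V}) : Prop :=
  exists x y, r x y /\ c (phi x) (phi y) <> c x y.

Definition edge_distinguishing (V : finType) (e : rel V) (k : nat)
    (c : {set V} -> 'I_k) : Prop :=
  forall phi : {perm V}, is_aut e phi -> phi <> 1%g -> edge_breaks e c phi.

Definition arc_distinguishing (V : finType) (r : rel V) (k : nat)
    (c : V -> V -> 'I_k) : Prop :=
  forall phi : {perm V}, is_aut r phi -> phi <> 1%g -> arc_breaks r c phi.

Definition is_least (P : nat -> Prop) (n : nat) : Prop :=
  P n /\ forall m, P m -> n <= m.

(* The indices are given by their graphs, as a distinguishing colouring need
   not exist (e.g. for K_2): [is_dist_index e d] says that D'(G) is defined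
   and equal to [d]. *)
Definition is_dist_index (V : finType) (e : rel V) : nat -> Prop :=
  is_least (fun k =>
    1 <= k /\ exists c : {set V} -> 'I_k, edge_distinguishing e c).

Definition is_arc_dist_index (V : finType) (r : rel V) : nat -> Prop :=
  is_least (fun k =>
    1 <= k /\ exists c : V -> V -> 'I_k, arc_distinguishing r c).

Definition is_orientation (V : finType) (e r : rel V) : Prop :=
  (forall x y, r x y -> e x y) /\ (forall x y, e x y -> r x y (+) r y x).

(* OD'^-(G) = m and OD'^+(G) = m; both include that the index of every
   orientation is defined. *)
Definition is_OD_minus (V : finType) (e : rel V) (m : nat) : Prop :=
  (exists2 r : rel V, is_orientation e r & is_arc_dist_index r m) /\
  (forall r : rel V, is_orientation e r ->
     exists2 n, is_arc_dist_index r n & m <= n).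

Definition is_OD_plus (V : finType) (e : rel V) (m : nat) : Prop :=
  (exists2 r : rel V, is_orientation e r & is_arc_dist_index r m) /\
  (forall r : rel V, is_orientation e r ->
     exists2 n, is_arc_dist_index r n & n <= m).

(* Main.v *)
Require Import Defs.
From mathcomp Require Import all_boot all_fingroup.
From Stdlib Require Import Classical.
Set Implicit Arguments.
Unset Strict Implicit.
Unset Printing Implicit Defensive.

(** Everything rests on one fact: the tree has an orientation [r0] that all its
    automorphisms preserve ([rooted_orientation]).  The hypothesis on the
    centre provides a vertex fixed by every automorphism; direct every edge
    away from it.

    Relative to [r0], an arbitrary orientation [r] is one bit per edge (does
    [r] agree with [r0] there?), and an automorphism of the tree preserves [r]
    exactly when it preserves these bits.  So an orientation together with an
    arc colouring in [m] colours carries the same information as an edge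
    colouring in [m + m] colours, and one is distinguishing iff the other is
    ([merge_arc_colouring], [split_edge_colouring]).  Hence the least [m] that
    suffices for some orientation is half of the distinguishing index, rounded
    up.

    For the maximum, an edge colouring that is distinguishing for the graph is
    distinguishing for each of its orientations, which have fewer
    automorphisms, and for [r0], which has the same automorphisms, nothing is
    gained by colouring arcs in place of edges.

    The distinguishing index exists because an automorphism that maps every
    edge to itself cannot swap the ends of an edge, as it preserves [r0]; so
    giving all edges different colours is distinguishing. *)

Lemma ex_least (P : nat -> Prop) n :
  P n -> exists2 m, is_least P m & m <= n.
Proof.
elim/ltn_ind: n => n IHn Pn.
have [[m [lt_mn Pm]]|noP] := classic (exists m, m < n /\ P m).
  by have [l lP le_lm] := IHn m lt_mn Pm; exists l => //; exact: leq_trans le_lm (ltnW lt_mn).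
exists n => //; split=> // m Pm; rewrite leqNgt; apply/negP => lt_mn.
by apply: noP; exists m.
Qed.

(** * Distinguishing colourings and orientations *)

Section Colourings.

Variable V : finType.
Implicit Types (e r : rel V) (phi : {perm V}).

Lemma edge_distinguishingP e k (c : {set V} -> 'I_k) :
  edge_distinguishing e c <->
  forall phi, is_aut e phi ->
    (forall x y, e x y -> c [set phi x; phi y] = c [set x; y]) -> phi = 1%g.
Proof.
split=> [dc phi autphi fixc|dc phi autphi phiN1].
  have [->//|/eqP/(dc _ autphi)[x [y [exy]]]] := eqVneq phi 1%g.
  by rewrite fixc.
have [/existsP[x /existsP[y /andP[exy /eqP neq]]]|nobreak] := boolP
    [exists x, exists y, e x y && (c [set phi x; phi y] != c [set x; y])].
  by exists x, y.
case: phiN1; apply: dc => // x y exy; apply/eqP/negPn/negP => neq.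
by case/existsP: nobreak; exists x; apply/existsP; exists y; rewrite exy.
Qed.

Lemma arc_distinguishingP r k (c : V -> V -> 'I_k) :
  arc_distinguishing r c <->
  forall phi, is_aut r phi ->
    (forall x y, r x y -> c (phi x) (phi y) = c x y) -> phi = 1%g.
Proof.
split=> [dc phi autphi fixc|dc phi autphi phiN1].
  have [->//|/eqP/(dc _ autphi)[x [y [rxy]]]] := eqVneq phi 1%g.
  by rewrite fixc.
have [/existsP[x /existsP[y /andP[rxy /eqP neq]]]|nobreak] := boolP
    [exists x, exists y, r x y && (c (phi x) (phi y) != c x y)].
  by exists x, y.
case: phiN1; apply: dc => // x y rxy; apply/eqP/negPn/negP => neq.
by case/existsP: nobreak; exists x; apply/existsP; exists y; rewrite rxy.
Qed.

Lemma edge_distinguishing_widen e k l (c : {set V} -> 'I_k) (le_kl : k <= l) :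
  edge_distinguishing e c ->
  edge_distinguishing e (fun A => widen_ord le_kl (c A)).
Proof.
move=> dc phi autphi /(dc phi autphi)[x [y [exy neq]]].
by exists x, y; split=> // /(congr1 val) /= /val_inj.
Qed.

Lemma orientation_edge e r : symmetric e -> is_orientation e r ->
  forall x y, e x y = r x y || r y x.
Proof.
move=> sym_e [sub tot] x y; apply/idP/orP => [/tot|[/sub|/sub]//].
  by case: (r x y); [left | right].
by rewrite sym_e.
Qed.

Lemma orientation_asym e r : is_orientation e r ->
  forall x y, r x y -> r y x = false.
Proof.
by case=> sub tot x y rxy; have := tot x y (sub _ _ rxy); rewrite rxy; case: (r y x).
Qed.

Lemma orientation_rev e r : is_orientation e r ->
  forall x y, e x y -> r y x = ~~ r x y.
Proof. by case=> _ tot x y /tot; case: (r x y); case: (r y x). Qed.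

Lemma aut_orientation e r phi :
  symmetric e -> is_orientation e r -> is_aut r phi -> is_aut e phi.
Proof.
by move=> sym_e or autphi x y; rewrite !(orientation_edge sym_e or) !autphi.
Qed.

Lemma edge_to_arc_distinguishing e r k (c : {set V} -> 'I_k) :
  symmetric e -> is_orientation e r -> edge_distinguishing e c ->
  arc_distinguishing r (fun x y => c [set x; y]).
Proof.
move=> sym_e or /edge_distinguishingP dc; apply/arc_distinguishingP.
move=> phi autphi fixc; apply: dc; first exact: aut_orientation or autphi.
move=> x y; rewrite (orientation_edge sym_e or) => /orP[|/fixc]; first exact: fixc.
by rewrite setUC => ->; rewrite setUC.
Qed.

(** The orientation selects one of the two orders of the ends of each edge, so
    a function of ordered pairs descends to edges; [f0] is the junk value on
    sets that are not edges. *)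
Lemma edge_fun_of_arc_fun e r (C : Type) (f0 : C) (f : V -> V -> C) :
  is_orientation e r ->
  exists g : {set V} -> C, forall x y, r x y -> g [set x; y] = f x y.
Proof.
move=> or.
pose P (A : {set V}) (p : V * V) := r p.1 p.2 && (A == [set p.1; p.2]).
exists (fun A => if pick (P A) is Some p then f p.1 p.2 else f0) => x y rxy.
case: pickP => [[a b]|/(_ (x, y))]; last by rewrite /P /= rxy eqxx.
move=> /andP[/= rab /eqP eqs].
have rN z : r z z = false.
  by apply/negP => rzz; have := orientation_asym or rzz; rewrite rzz.
have: x \in [set a; b] by rewrite -eqs set21.
have: y \in [set a; b] by rewrite -eqs set22.
rewrite !inE => /orP[]/eqP yE /orP[]/eqP xE; subst x y => //.
- by rewrite rN in rxy.
- by rewrite (orientation_asym or rab) in rxy.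
- by rewrite rN in rxy.
Qed.

(** * Graphs with an automorphism-invariant orientation *)

Section InvariantOrientation.

Variables e r0 : rel V.
Hypotheses (sym_e : symmetric e) (or0 : is_orientation e r0).
Hypothesis inv_r0 : forall phi, is_aut e phi -> is_aut r0 phi.

Lemma arc_to_edge_distinguishing k (c : V -> V -> 'I_k) :
  0 < k -> arc_distinguishing r0 c ->
  exists c' : {set V} -> 'I_k, edge_distinguishing e c'.
Proof.
move=> k_gt0 /arc_distinguishingP dc.
have [g gE] := edge_fun_of_arc_fun (Ordinal k_gt0) c or0.
exists g; apply/edge_distinguishingP => phi autphi fixg.
have aut0 := inv_r0 autphi; apply: dc => // x y rxy.
by rewrite -!gE ?aut0 // fixg //; apply: or0.1.
Qed.

(** The two halves of the doubled palette record whether [r] agrees with [r0]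
    on the edge. *)
Lemma merge_arc_colouring r k (c : V -> V -> 'I_k) :
  0 < k -> is_orientation e r -> arc_distinguishing r c ->
  exists c' : {set V} -> 'I_(k + k), edge_distinguishing e c'.
Proof.
move=> k_gt0 or /arc_distinguishingP dc.
pose f x y := if r x y then lshift k (c x y) else rshift k (c y x).
have [g gE] := edge_fun_of_arc_fun (lshift k (Ordinal k_gt0)) f or0.
exists g; apply/edge_distinguishingP => phi autphi fixg.
have aut0 := inv_r0 autphi.
have fixf x y : r0 x y -> f (phi x) (phi y) = f x y.
  by move=> rxy; rewrite -!gE ?aut0 // fixg //; apply: or0.1.
have fixr0 x y : r0 x y -> r (phi x) (phi y) = r x y.
  move/fixf; rewrite /f; case: (r x y); case: (r (phi x) (phi y)) => //.
    by move/eqP; rewrite eq_rlshift.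
  by move/eqP; rewrite eq_lrshift.
apply: dc => x y.
  have [exy|nexy] := boolP (e x y); last first.
    by rewrite !(contraNF (@or.1 _ _)) ?autphi.
  have:= exy; rewrite (orientation_edge sym_e or0) => /orP[/fixr0//|/fixr0 eq_r].
  rewrite sym_e in exy; rewrite (orientation_rev or exy) -eq_r.
  by apply: orientation_rev or _ _ _; rewrite autphi.
move=> rxy; have := or.1 _ _ rxy.
rewrite (orientation_edge sym_e or0) => /orP[] r0xy;
  have := fixf _ _ r0xy; rewrite /f fixr0 //.
  by rewrite rxy => /lshift_inj.
by rewrite (orientation_asym or rxy) => /rshift_inj.
Qed.

(** The converse encoding: the half of the palette in which the colour of an
    edge lies decides whether [r] directs the edge as [r0] does. *)
Lemma split_edge_colouring m (c : {set V} -> 'I_(m + m)) :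
  edge_distinguishing e c ->
  exists2 r, is_orientation e r &
    exists c' : V -> V -> 'I_m, arc_distinguishing r c'.
Proof.
move=> /edge_distinguishingP dc.
pose lower A := if split (c A) is inl _ then true else false.
pose colour A := match split (c A) with inl i => i | inr i => i end.
pose r x y := e x y && (r0 x y == lower [set x; y]).
have or : is_orientation e r.
  split=> [x y /andP[]//|x y exy].
  rewrite /r (sym_e y x) exy (setUC [set y]) (orientation_rev or0 exy).
  by case: (r0 x y); case: (lower _).
exists r => //; exists (fun x y => colour [set x; y]).
apply/arc_distinguishingP => phi autr fixc.
have aute := aut_orientation sym_e or autr; have aut0 := inv_r0 aute.
have fixr x y : r x y -> c [set phi x; phi y] = c [set x; y].
  move=> rxy; have := fixc _ _ rxy.
  have /andP[_ /eqP] := rxy; have := rxy; rewrite -autr => /andP[_ /eqP].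
  rewrite aut0 => -> eq_lower eq_colour; apply: (can_inj (@splitK m m)).
  move: eq_lower eq_colour; rewrite /lower /colour.
  by case: (split _) => i; case: (split _) => j // _ ->.
apply: dc => // x y; rewrite (orientation_edge sym_e or) => /orP[|/fixr].
  exact: fixr.
by rewrite setUC => ->; rewrite setUC.
Qed.

Lemma arc_index_le r k (c : {set V} -> 'I_k) : 0 < k ->
  is_orientation e r -> edge_distinguishing e c ->
  exists2 n, is_arc_dist_index r n & n <= k.
Proof.
move=> k_gt0 or dc; apply: ex_least; split=> //.
by exists (fun x y => c [set x; y]); apply: edge_to_arc_distinguishing or dc.
Qed.

Lemma OD_indices d : is_dist_index e d ->
  is_OD_minus e (uphalf d) /\ is_OD_plus e d.
Proof.
case=> -[d_gt0 [c dc]] min_d.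
have lower_bound r k : is_orientation e r -> 1 <= k ->
    (exists c' : V -> V -> 'I_k, arc_distinguishing r c') -> uphalf d <= k.
  move=> or k_gt0 [c' dc']; rewrite leq_uphalf_double -addnn.
  apply: min_d; split; first by rewrite addn_gt0 k_gt0.
  exact: merge_arc_colouring or dc'.
split; split.
- have le_d : d <= uphalf d + uphalf d by rewrite addnn -leq_uphalf_double.
  have [r or rP] := split_edge_colouring (edge_distinguishing_widen le_d dc).
  exists r => //; split; last by move=> k [k_gt0]; apply: lower_bound.
  by split=> //; rewrite uphalf_gt0.
- move=> r or; have [n nP _] := arc_index_le d_gt0 or dc.
  by exists n => //; case: nP => -[n_gt0 nP] _; apply: lower_bound or _ nP.
- exists r0 => //; split.
    split=> //; exists (fun x y => c [set x; y]).
    exact: edge_to_arc_distinguishing or0 dc.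
  move=> k [k_gt0 [c' dc']]; apply: min_d; split=> //.
  exact: arc_to_edge_distinguishing dc'.
- by move=> r or; apply: arc_index_le or dc.
Qed.

(** Colour all edges differently: the invariant orientation tells the ends of
    an edge apart, so an automorphism mapping every edge to itself fixes every
    vertex that lies on an edge, and by connectedness these are all vertices
    except possibly [root]. *)
Lemma ex_dist_index (root : V) :
  (forall phi, is_aut e phi -> phi root = root) ->
  (forall x y, connect e x y) ->
  exists d, is_dist_index e d.
Proof.
move=> fix_root conn.
have [|d dP _] := @ex_least
    (fun k => 1 <= k /\ exists c : {set V} -> 'I_k, edge_distinguishing e c)
    #|{set V}|; last by exists d.
split; first by apply/card_gt0P; exists set0.
exists enum_rank; apply/edge_distinguishingP => phi autphi fixc.
have fix_arc x y : r0 x y -> phi x = x /\ phi y = y.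
  move=> rxy; have exy := or0.1 _ _ rxy.
  have /enum_rank_inj eqs := fixc _ _ exy.
  have phi_neq : phi x != phi y.
    apply/eqP => /perm_inj xy; subst y.
    by have := orientation_asym or0 rxy; rewrite rxy.
  have: phi x \in [set x; y] by rewrite -eqs set21.
  have: phi y \in [set x; y] by rewrite -eqs set22.
  rewrite !inE => /orP[]/eqP yE /orP[]/eqP xE //.
  - by rewrite xE yE eqxx in phi_neq.
  - have := inv_r0 autphi x y; rewrite xE yE rxy.
    by rewrite (orientation_asym or0 rxy).
  - by rewrite xE yE eqxx in phi_neq.
apply/permP => x; rewrite perm1.
have /connectP[[|y p] /=] := conn x root.
  by move=> _ <-; apply: fix_root.
by case/andP=> + _ _; rewrite (orientation_edge sym_e or0) => /orP[]/fix_arc[].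
Qed.

End InvariantOrientation.

(** * Rooted trees *)

Definition del_edge (e : rel V) (x y : V) : rel V :=
  fun a b => [&& e a b, (a, b) != (x, y) & (a, b) != (y, x)].

(** The end [x] of an edge is nearer to the root than the end [y] iff it stays
    connected to the root when the edge is deleted.  In this form invariance
    under the automorphisms that fix the root is immediate. *)
Definition away (e : rel V) (root : V) : rel V :=
  fun x y => e x y && connect (del_edge e x y) root x.

Lemma del_edge_sym e x y : symmetric e -> symmetric (del_edge e x y).
Proof.
move=> sym_e a b; rewrite /del_edge sym_e !xpair_eqE.
by rewrite (andbC (b == x)) (andbC (b == y)) [X in _ && X]andbC.
Qed.

Lemma del_edgeC e x y : del_edge e x y =2 del_edge e y x.
Proof. by move=> a b; rewrite /del_edge; congr (_ && _); rewrite andbC. Qed.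

Lemma connect_perm r r' phi x y :
  (forall a b, r a b -> r' (phi a) (phi b)) ->
  connect r x y -> connect r' (phi x) (phi y).
Proof.
move=> mor /connectP[p pP ->]; apply/connectP; exists (map phi p).
  by elim: p x pP => //= z p IHp x /andP[/mor -> /IHp].
by rewrite last_map.
Qed.

Lemma is_autV r phi : is_aut r phi -> is_aut r phi^-1%g.
Proof. by move=> autphi x y; rewrite -autphi !permKV. Qed.

Lemma aut_away e root phi :
  is_aut e phi -> phi root = root -> is_aut (away e root) phi.
Proof.
have half psi x y : is_aut e psi -> psi root = root ->
    away e root x y -> away e root (psi x) (psi y).
  move=> autpsi psir /andP[exy con]; rewrite /away autpsi exy -{1}psir /=.
  apply: connect_perm con => a b; rewrite /del_edge autpsi.
  by rewrite !xpair_eqE !(inj_eq perm_inj).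
move=> autphi phir x y; apply/idP/idP; last exact: half.
move/(half phi^-1%g); rewrite !permK; apply; first exact: is_autV.
by rewrite -{1}phir permK.
Qed.

(** If both ends stayed connected to the root, the deleted edge would close a
    cycle; and a simple path from the root to one end either avoids the other
    end, or reaches it first. *)
Lemma rooted_orientation e root : is_tree e -> is_orientation e (away e root).
Proof.
case=> sym_e irr_e _ conn acyc; split=> [x y /andP[]//|x y exy].
have neq_xy : x != y by apply: contraTneq exy => ->; rewrite irr_e.
rewrite /away (sym_e y x) exy /= (eq_connect (del_edgeC e y x)).
have conn_sym := sym_connect_sym (@del_edge_sym e x y sym_e).
have not_both : connect (del_edge e x y) root x ->
    connect (del_edge e x y) root y -> False.
  rewrite conn_sym => xr ry.
  have /connectP[p0 p0P lastp0] := connect_trans xr ry.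
  move: lastp0; case/shortenP: p0P => p pP up _ lastp {p0}.
  apply: (acyc (x :: p)).
    case: p pP lastp {up} => [_ /= xE|z [|//]]; first by rewrite xE eqxx in neq_xy.
    by move=> /= /andP[/and3P[_ nxy _] _] yE; rewrite yE eqxx in nxy.
  rewrite /ucycle up andbT /= rcons_path -lastp sym_e exy andbT.
  by apply: sub_path pP => a b /and3P[].
have avoid z w p : path e root p -> w \notin root :: p ->
    (w == x) || (w == y) -> last root p = z -> connect (del_edge e x y) root z.
  move=> pP wNp wxy <-; apply/connectP; exists p => //.
  elim: p (root) pP wNp => //= b p IHp a /andP[eab pP].
  rewrite !inE !negb_or => /and3P[wNa wNb wNp].
  rewrite IHp //; last by rewrite inE negb_or wNb.
  rewrite andbT /del_edge eab !xpair_eqE !negb_and.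
  by case/orP: wxy => /eqP wE; rewrite -wE !(eq_sym _ w) wNa wNb ?orbT.
have one_of : connect (del_edge e x y) root x || connect (del_edge e x y) root y.
  have /connectP[p0 p0P lastp0] := conn root x.
  move: lastp0; case/shortenP: p0P => p pP up _ lastp {p0}.
  have [yp|yNp] := boolP (y \in root :: p); last first.
    by rewrite (avoid x y p) ?eqxx ?orbT.
  apply/orP; right.
  case/splitPl: yp pP up lastp => p1 p2 lastp1.
  rewrite cat_path -cat_cons cat_uniq last_cat lastp1.
  move=> /andP[p1P _] /and3P[_ disj _] lastp2.
  apply: (avoid y x p1) => //; last by rewrite eqxx.
  apply: contra disj => xp1; apply/hasP; exists x => //.
  by rewrite {1}lastp2; case: p2 lastp2 => [xE|b p2 _];
    [rewrite xE eqxx in neq_xy | rewrite /= mem_last].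
by case: (connect _ _ x) one_of not_both;
  case: (connect _ _ y) => //= _ /(_ isT isT).
Qed.

(** * Automorphisms preserve the centre *)

Lemma aut_dist e phi x y : is_aut e phi -> dist e (phi x) (phi y) = dist e x y.
Proof.
have half psi u v n : is_aut e psi ->
    [exists p : n.-tuple V, path e u p && (last u p == v)] ->
    [exists p : n.-tuple V, path e (psi u) p && (last (psi u) p == psi v)].
  move=> autpsi /existsP[p /andP[pP /eqP <-]].
  apply/existsP; exists [tuple of map psi p]; rewrite /= last_map eqxx andbT.
  by elim: (tval p) u pP => //= z q IHq u /andP[+ /IHq ->]; rewrite autpsi => ->.
move=> autphi; apply: eq_find => n; apply/idP/idP; last exact: half.
by move/(half _ _ _ _ (is_autV autphi)); rewrite !permK.
Qed.

Lemma aut_eccentricity e phi x :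
  is_aut e phi -> eccentricity e (phi x) = eccentricity e x.
Proof.
move=> autphi; rewrite /eccentricity (reindex_inj (@perm_inj _ phi)) /=.
by apply: eq_bigr => y _; rewrite aut_dist.
Qed.

Lemma aut_centre e phi x :
  is_aut e phi -> x \in centre e -> phi x \in centre e.
Proof. by move=> autphi; rewrite !inE aut_eccentricity. Qed.

End Colourings.

Theorem corollary8 (V : finType) (e : rel V)
    (hT : is_tree e)
    (hK2 : ~ isomorphic e (@complete_graph 2))
    (hC : (exists x, centre e = [set x]) \/
          (exists x y, [/\ e x y, centre e = [set x; y] &
             forall phi : {perm V}, is_aut e phi -> phi x = x /\ phi y = y])) :
  exists d, [/\ is_dist_index e d,
                is_OD_minus e (uphalf d)
              & is_OD_plus e d].
Proof.
have [root fix_root] : exists root,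
    forall phi : {perm V}, is_aut e phi -> phi root = root.
  case: hC => [[x cx]|[x [y [_ _ fixxy]]]]; exists x => phi autphi.
    by apply/set1P; rewrite -cx aut_centre // cx set11.
  by case: (fixxy phi autphi).
have [sym_e _ _ conn _] := hT.
have or0 := rooted_orientation root hT.
have inv_r0 phi : is_aut e phi -> is_aut (away e root) phi.
  by move=> autphi; apply: aut_away (fix_root _ autphi).
have [d dP] := ex_dist_index sym_e or0 inv_r0 fix_root conn.
by exists d; have [] := OD_indices sym_e or0 inv_r0 dP.
Qed.
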